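(* Let $k$ be an $F$-finite field of characteristic $p>0$, and let $R$ be a strongly $F$-regular $k$-algebra, essentially of finite type over $k$, which is diagonally $F$-split over $k$. Let $\mathfrak a\subseteq R$ be an ideal not contained in any minimal prime of $R$, and let $s$ and $t$ be positive real numbers with $s+t\in\mathbb Z$. Then $$\mathfrak a^{s+t}\subseteq \tau(\mathfrak a^{s-\epsilon})\,\tau(\mathfrak a^{t-\epsilon})$$ for all real $\epsilon\in(0,\min\{s,t\}]$.
   Context: All rings are commutative. For a ring $R$ of prime characteristic $p$ and $e\ge 0$, $F^e_*$ denotes restriction of scalars along the $e$-th iterate of Frobenius $F^e\colon R\to R$, $x\mapsto x^{p^e}$: for an $R$-module $M$, $F^e_*M=\{F^e_*m : m\in M\}$ with $F^e_*m+F^e_*n=F^e_*(m+n)$ and $rF^e_*m=F^e_*(r^{p^e}m)$. $R$ is $F$-finite if $F^e_*R$ is a finitely generated $R$-module for some (equivalently all) $e>0$. An $F$-splitting of $R$ is an $R$-linear map $F^e_*R\to R$ (with $e>0$) sending $F^e_*1$ to $1$. Let $R$ be $F$-finite, reduced and Noetherian of characteristic $p$, and let $R^\circ$ be the set of elements of $R$ not in any minimal prime. $R$ is strongly $F$-regular if for every $d\in R^\circ$ there exist $e>0$ and $\varphi\in\operatorname{Hom}_R(F^e_*R,R)$ with $\varphi(F^e_*d)=1$. Test ideals: let $\mathfrak a$ be an ideal of $R$ not contained in any minimal prime and $t\ge 0$ a real number. A test element of the pair $(R,\mathfrak a^t)$ is an element $c\in R^\circ$ such that for all $d\in R^\circ$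 there exist $e>0$ and $\varphi\in \operatorname{Hom}_R(F^e_*R,R)$ with $c\in\varphi\big(F^e_*(d\,\mathfrak a^{\lceil t(p^e-1)\rceil})\big)$. Test elements exist, and $$\tau(\mathfrak a^t)=\tau(R,\mathfrak a^t)=\sum_{e>0}\ \sum_{\varphi\in\operatorname{Hom}_R(F^e_*R,R)}\varphi\big(F^e_*(c\,\mathfrak a^{\lceil t(p^e-1)\rceil})\big),$$ where $c$ is any test element of $(R,\mathfrak a^t)$ (the ideal does not depend on $c$). By convention $\mathfrak a^0=R$. Diagonal $F$-splitting: let $\mu\colon R\otimes_kR\to R$, $\mu(x\otimes y)=xy$. $R$ is diagonally $F$-split over $k$ if for some $e>0$ there is an $F$-splitting $\varphi\colon F^e_*(R\otimes_kR)\to R\otimes_kR$ of $R\otimes_k R$ with $\varphi(F^e_*\ker\mu)\subseteq\ker\mu$. *)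

(* Defs.v *)
From HB Require Import structures.
From mathcomp Require Import all_boot all_order all_algebra.
From mathcomp Require Import boolp classical_sets reals.
From mathcomp Require Import ring.
From mathcomp Require mpoly.

Set Implicit Arguments.
Unset Strict Implicit.
Unset Printing Implicit Defensive.

Import Order.TTheory GRing.Theory Num.Theory.
Local Open Scope classical_set_scope.
Local Open Scope quotient_scope.
Local Open Scope ring_scope.

Section Ideals.
Variable R : comNzRingType.
Implicit Types (I J P A : set R) (n : nat).

Definition is_ideal I : Prop :=
  [/\ I 0, forall x y, I x -> I y -> I (x + y) & forall r x, I x -> I (r * x)].

Definition ideal_gen A : set R :=
  [set x | forall I, is_ideal I -> A `<=` I -> I x].

Definition ideal_mul I J : set R := ideal_gen [set x * y | x in I & y in J].

(* [ideal_exp I 0] is the unit ideal, whatever [I] is. *)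
Definition ideal_exp I n : set R := iter n (ideal_mul I) setT.

Definition is_prime_ideal P : Prop :=
  [/\ is_ideal P, ~ P 1 & forall x y, P (x * y) -> P x \/ P y].

Definition is_minimal_prime P : Prop :=
  is_prime_ideal P /\ forall Q, is_prime_ideal Q -> Q `<=` P -> Q = P.

Definition off_minimal_primes : set R :=
  [set x | forall P, is_minimal_prime P -> ~ P x].

Definition is_reduced : Prop := forall (x : R) n, x ^+ n = 0 -> x = 0.

Definition is_noetherian : Prop :=
  forall I, is_ideal I -> exists s : seq R, I = ideal_gen [set` s].

Lemma ideal_gen_ideal A : is_ideal (ideal_gen A).
Proof.
split=> [I [I0 _ _] _ //|x y Ax Ay I II AI|r x Ax I II AI].
  by have [_ ID _] := II; apply: ID; [exact: Ax | exact: Ay].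
by have [_ _ IM] := II; apply: IM; exact: Ax.
Qed.

Lemma sub_ideal_gen A : A `<=` ideal_gen A.
Proof. by move=> x Ax I _; exact. Qed.

Lemma ideal_exp_ideal I n : is_ideal (ideal_exp I n).
Proof. by case: n => [|n]; [split | exact: ideal_gen_ideal]. Qed.

Lemma ideal_expD I m n x y :
  ideal_exp I m x -> ideal_exp I n y -> ideal_exp I (m + n) (x * y).
Proof.
move=> Imx Iny; elim: m x Imx => [|m IHm] x Imx.
  by have [_ _] := ideal_exp_ideal I n; apply.
pose J := [set z | ideal_exp I (m.+1 + n) (z * y)].
have [J0 JD JM] := ideal_exp_ideal I (m.+1 + n).
apply: (Imx J); first split; rewrite /J /=.
- by rewrite mul0r.
- by move=> a b Ja Jb; rewrite mulrDl; exact: JD.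
- by move=> r a Ja; rewrite -mulrA; exact: JM.
move=> _ [a Ia [b Ib <-]]; rewrite /= -mulrA; apply: sub_ideal_gen.
by exists a => //; exists (b * y) => //; exact: IHm.
Qed.

Lemma ideal_expX I m n x :
  ideal_exp I m x -> ideal_exp I (m * n) (x ^+ n).
Proof.
by move=> Imx; elim: n => [|n IHn];
  rewrite ?muln0 // mulnS exprS; exact: ideal_expD.
Qed.

Lemma ideal_exp_le I m n : is_ideal I -> (m <= n)%N ->
  ideal_exp I n `<=` ideal_exp I m.
Proof.
move=> II; elim: n m => [|n IHn] [|m] // le_mn x Inx.
apply: Inx => [|_ [a Ia [b Ib <-]]]; first exact: ideal_gen_ideal.
by apply: sub_ideal_gen; exists a => //; exists b => //; apply: IHn Ib.
Qed.

End Ideals.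

(* The additive group of [R]; the element [F^e_* x] is [x] itself. *)
Definition Fpush (R : comNzRingType) (p : nat) of p \in [pchar R] & nat : Type
  := R.

Section FpushModule.
Variables (R : comNzRingType) (p : nat) (chR : p \in [pchar R]) (e : nat).
Local Notation M := (Fpush chR e).

HB.instance Definition _ := GRing.Zmodule.on M.

Definition Fpush_scale (r : R) (x : M) : M := (r ^+ (p ^ e) * (x : R) : R).

Fact Fpush_scaleA a b x :
  Fpush_scale a (Fpush_scale b x) = Fpush_scale (a * b) x.
Proof. by rewrite /Fpush_scale exprMn mulrA. Qed.

Fact Fpush_scale1 : left_id 1 Fpush_scale.
Proof. by move=> x; rewrite /Fpush_scale expr1n mul1r. Qed.

Fact Fpush_scaleDr : right_distributive Fpush_scale +%R.
Proof. by move=> a x y; exact: mulrDr. Qed.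

Fact Fpush_scaleDl x : {morph Fpush_scale^~ x : a b / a + b}.
Proof.
move=> a b; rewrite /Fpush_scale exprDn_pchar ?mulrDl//.
by apply/pnatP => [|q qpr]; rewrite ?expn_gt0 ?(prime_gt0 (pcharf_prime chR))//
  Euclid_dvdX// => /andP[]; rewrite dvdn_prime2 ?(pcharf_prime chR)// => /eqP->.
Qed.

HB.instance Definition _ := GRing.Zmodule_isLmodule.Build R M
  Fpush_scaleA Fpush_scale1 Fpush_scaleDr Fpush_scaleDl.

End FpushModule.

Definition F_finite (R : comNzRingType) p (chR : p \in [pchar R]) : Prop :=
  exists2 e, (0 < e)%N &
    exists s : seq (Fpush chR e), forall x : Fpush chR e,
      exists c : 'I_(size s) -> R, x = \sum_i c i *: s`_i.

Definition strongly_F_regular (R : comNzRingType) p (chR : p \in [pchar R])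
    : Prop :=
  [/\ F_finite chR, is_reduced R, is_noetherian R &
      forall d : R, off_minimal_primes d ->
        exists2 e, (0 < e)%N &
          exists phi : {linear Fpush chR e -> R^o}, phi d = 1].

Section TestIdeals.
Variables (R : comNzRingType) (p : nat) (chR : p \in [pchar R]).
Variables (K : realType) (a : set R) (t : K).

(* The ideal a^ceil(t (p^e - 1)); the ceiling is nonnegative when 0 <= t. *)
Definition ceil_exp (e : nat) : set R :=
  ideal_exp a `|Num.ceil (t * (p%:R ^+ e - 1))|%N.

(* phi (F^e_* (c a^ceil(t (p^e - 1)))) *)
Definition test_image (c : R) e (phi : {linear Fpush chR e -> R^o}) : set R :=
  [set (phi (c * x) : R) | x in ceil_exp e].

Definition is_test_element (c : R) : Prop :=
  off_minimal_primes c /\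
  forall d : R, off_minimal_primes d ->
    exists2 e, (0 < e)%N &
      exists phi : {linear Fpush chR e -> R^o}, test_image d phi c.

(* A sum of ideals is the ideal generated by their union. *)
Definition test_sum (c : R) : set R :=
  ideal_gen [set x | exists2 e, (0 < e)%N &
    exists phi : {linear Fpush chR e -> R^o}, test_image c phi x].

Definition Fpush_comp e e' (phi : {linear Fpush chR e -> R^o})
  (psi : {linear Fpush chR e' -> R^o}) (x : Fpush chR (e' + e)) : R^o :=
  phi (psi x).

Fact Fpush_comp_linear e e' phi psi : linear (@Fpush_comp e e' phi psi).
Proof.
move=> r x y; rewrite /Fpush_comp -linearP; congr (phi _).
have -> : r *: x + y = (r ^+ (p ^ e) : R) *: (x : Fpush chR e') + y.
  congr (_ + _); change (r ^+ (p ^ (e' + e)) * (x : R) =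
    (r ^+ (p ^ e)) ^+ (p ^ e') * (x : R)).
  by rewrite -exprM -expnD addnC.
by rewrite linearP.
Qed.

HB.instance Definition _ e e' phi psi :=
  GRing.isLinear.Build R (Fpush chR (e' + e)) R^o *:%R (@Fpush_comp e e' phi psi)
    (@Fpush_comp_linear e e' phi psi).

Lemma ceil_exp_comp e e' : 0 <= t ->
  (`|Num.ceil (t * (p%:R ^+ (e' + e) - 1))|%N <=
   `|Num.ceil (t * (p%:R ^+ e' - 1))|%N +
   `|Num.ceil (t * (p%:R ^+ e - 1))|%N * p ^ e')%N.
Proof.
move=> t0; have p1 : 1 <= p%:R :> K.
  by rewrite ler1n (prime_gt0 (pcharf_prime chR)).
have ce0 n : 0 <= t * (p%:R ^+ n - 1) by rewrite mulr_ge0// subr_ge0 exprn_ege1.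
have cE n : (`|Num.ceil (t * (p%:R ^+ n - 1))|%N : int) =
    Num.ceil (t * (p%:R ^+ n - 1)).
  by rewrite gez0_abs// ceil_ge0; apply: lt_le_trans (ce0 n); rewrite ltrN10.
rewrite -lez_nat PoszD PoszM !cE ceil_le_int rmorphD rmorphM /=.
have -> : (Posz (p ^ e'))%:~R = p%:R ^+ e' :> K by rewrite -natrX.
apply: le_trans (lerD (ceil_ge _) (ler_wpM2r _ (ceil_ge _))); last first.
  by rewrite exprn_ge0// ler0n.
by rewrite exprD le_eqVlt; apply/orP; left; apply/eqP; ring.
Qed.

Lemma sub_test_sum c c' : 0 <= t -> is_ideal a ->
  is_test_element c -> off_minimal_primes c' -> test_sum c `<=` test_sum c'.
Proof.
move=> t0 aI [_ cT] c'R x; apply; first exact: ideal_gen_ideal.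
move=> _ [e e0 [phi [y ay <-]]]; apply: sub_ideal_gen.
have [e' e'0 [psi [z az zc]]] := cT _ c'R.
exists (e' + e)%N; first by rewrite addn_gt0 e'0.
exists (Fpush_comp phi psi); exists (z * y ^+ (p ^ e')).
  apply: ideal_exp_le (ceil_exp_comp e e' t0) _ _ => //.
  exact: ideal_expD az (ideal_expX _ ay).
rewrite /= /Fpush_comp; congr (phi _).
rewrite -zc [in RHS]mulrC -[RHS]/(y *: (psi (c' * z) : R^o)) -linearZ.
congr (psi _); change (c' * (z * y ^+ (p ^ e')) = y ^+ (p ^ e') * (c' * z)).
by rewrite mulrA mulrC.
Qed.

(* [xget] picks a test element; the result does not depend on the choice, see
   [test_idealE] below. *)
Definition test_ideal : set R := test_sum (xget 0 is_test_element).

Lemma test_idealE c : 0 <= t -> is_ideal a ->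
  is_test_element c -> test_ideal = test_sum c.
Proof.
move=> t0 aI cT; rewrite /test_ideal.
case: xgetP => [c' _ c'T|/(_ c)//].
by apply/seteqP; split; apply: sub_test_sum => //; [case: cT | case: c'T].
Qed.

End TestIdeals.

Section EssFiniteType.
Variable k : fieldType.

Definition is_finite_type (A : comAlgType k) : Prop :=
  exists n (v : 'I_n -> A),
    forall x, exists P : mpoly.mpoly n k, x = mpoly.mmap (GRing.in_alg A) v P.

Definition is_mul_set (A : comNzRingType) (S : set A) : Prop :=
  S 1 /\ forall x y, S x -> S y -> S (x * y).

(* [f] exhibits [B] as the localization of [A] at [S]. *)
Definition is_localization (A B : comNzRingType) (S : set A)
    (f : {rmorphism A -> B}) : Prop :=
  [/\ forall s, S s -> exists u, f s * u = 1,
      forall y, exists x, exists2 s, S s & y * f s = f x &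
      forall x, f x = 0 -> exists2 s, S s & s * x = 0].

Definition is_ess_finite_type (R : comAlgType k) : Prop :=
  exists (A : comAlgType k) (S : set A) (f : {lrmorphism A -> R}),
    [/\ is_finite_type A, is_mul_set S & is_localization S f].

End EssFiniteType.

(* Formal sums of pairs, two of them being identified when every k-bilinear map
   on R x R sends them to the same element. *)
Section TensorSquare.
Variables (k : fieldType) (R : comAlgType k).
Local Notation bilin f := (bilinear_for *:%R *:%R f).
Implicit Types (s t u : seq (R * R)).

Definition bisum (V : lmodType k) (f : R -> R -> V) s : V :=
  \sum_(xy <- s) f xy.1 xy.2.

Definition tensor_eq s t : bool :=
  `[< forall (V : lmodType k) (f : R -> R -> V), bilin f ->
        bisum f s = bisum f t >].

Fact tensor_eq_refl : reflexive tensor_eq.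
Proof. by move=> s; apply/asboolP. Qed.

Fact tensor_eq_sym : symmetric tensor_eq.
Proof.
by move=> s t; apply/asboolP/asboolP => st V f fl; rewrite (st V f fl).
Qed.

Fact tensor_eq_trans : transitive tensor_eq.
Proof.
move=> t s u /asboolP st /asboolP tu; apply/asboolP => V f fl.
by rewrite (st V f fl) (tu V f fl).
Qed.

Canonical tensor_equiv :=
  EquivRel tensor_eq tensor_eq_refl tensor_eq_sym tensor_eq_trans.

Definition tensor_square : Type := {eq_quot tensor_equiv}%qT.
HB.instance Definition _ := Choice.on tensor_square.
Local Notation T := tensor_square.

Definition tcls s : T := \pi_({eq_quot tensor_equiv}%qT) s.
Definition trep (x : T) : seq (R * R) := repr (x : {eq_quot tensor_equiv}%qT).

Lemma trepK : cancel trep tcls. Proof. exact: reprK. Qed.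

Lemma tclsP s t : tcls s = tcls t <->
  forall (V : lmodType k) (f : R -> R -> V), bilin f -> bisum f s = bisum f t.
Proof.
split=> [/eqP|st]; first by rewrite eqquotE => /asboolP.
by apply/eqP; rewrite eqquotE; apply/asboolP.
Qed.

Lemma trepE s (V : lmodType k) (f : R -> R -> V) :
  bilin f -> bisum f (trep (tcls s)) = bisum f s.
Proof. by move=> fl; have /tclsP := trepK (tcls s); apply. Qed.

Definition tadd (x y : T) : T := tcls (trep x ++ trep y).
Definition topp (x : T) : T := tcls [seq (- xy.1, xy.2) | xy <- trep x].
Definition tscale (c : k) (x : T) : T :=
  tcls [seq (c *: xy.1, xy.2) | xy <- trep x].
Definition tmul (x y : T) : T :=
  tcls [seq (ab.1 * cd.1, ab.2 * cd.2) | ab <- trep x, cd <- trep y].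
Definition tensor (x y : R) : T := tcls [:: (x, y)].

Let bilinl (V : lmodType k) (f : R -> R -> V) : bilin f ->
  forall c x y z, f (c *: x + y) z = c *: f x z + f y z.
Proof. by case=> fl _ c x y z; exact: fl. Qed.

Let bilinr (V : lmodType k) (f : R -> R -> V) : bilin f ->
  forall c x y z, f z (c *: x + y) = c *: f z x + f z y.
Proof. by case=> _ fl c x y z; exact: fl. Qed.

Let bilin0l (V : lmodType k) (f : R -> R -> V) : bilin f -> forall z, f 0 z = 0.
Proof.
move=> fl z; have := bilinl fl 1 0 0 z.
by rewrite !scale1r addr0 => /eqP; rewrite -subr_eq subrr => /eqP.
Qed.

Let bilinZl (V : lmodType k) (f : R -> R -> V) : bilin f ->
  forall c x z, f (c *: x) z = c *: f x z.
Proof.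
by move=> fl c x z; rewrite -[c *: x]addr0 bilinl// (bilin0l fl) addr0.
Qed.

Lemma bisum_cat (V : lmodType k) (f : R -> R -> V) s t :
  bisum f (s ++ t) = bisum f s + bisum f t.
Proof. exact: big_cat. Qed.

Lemma bisum_scale (V : lmodType k) (f : R -> R -> V) : bilin f -> forall c s,
  bisum f [seq (c *: xy.1, xy.2) | xy <- s] = c *: bisum f s.
Proof.
move=> fl c s; rewrite /bisum big_map scaler_sumr.
by apply: eq_bigr => -[x y] _ /=; rewrite bilinZl.
Qed.

Lemma bisum_opp (V : lmodType k) (f : R -> R -> V) : bilin f -> forall s,
  bisum f [seq (- xy.1, xy.2) | xy <- s] = - bisum f s.
Proof.
move=> fl s; rewrite -scaleN1r -bisum_scale//; congr bisum.
by apply: eq_map => xy; rewrite scaleN1r.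
Qed.

Lemma bisum_mul (V : lmodType k) (f : R -> R -> V) s t :
  bisum f [seq (ab.1 * cd.1, ab.2 * cd.2) | ab <- s, cd <- t] =
  bisum (fun a b => bisum (fun c d => f (a * c) (b * d)) t) s.
Proof. by rewrite /bisum big_allpairs_dep. Qed.

Lemma bisumC (V : lmodType k) (f : R -> R -> R -> R -> V) s t :
  bisum (fun a b => bisum (f a b) t) s =
  bisum (fun c d => bisum (fun a b => f a b c d) s) t.
Proof. exact: exchange_big. Qed.

Lemma eq_bisum (V : lmodType k) (f g : R -> R -> V) s :
  (forall x y, f x y = g x y) -> bisum f s = bisum g s.
Proof. by move=> fg; apply: eq_bigr => ? _; exact: fg. Qed.

Lemma bilin_bisum (V : lmodType k) (f : R -> R -> V) : bilin f ->
  forall t, bilin (fun a b => bisum (fun c d => f (a * c) (b * d)) t).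
Proof.
move=> fl t; split=> [z|z] r x y /=;
  rewrite /bisum scaler_sumr -big_split; apply: eq_bigr => -[c d] _ /=;
  rewrite mulrDl -scalerAl; [exact: bilinl | exact: bilinr].
Qed.

Lemma bilin_mull (V : lmodType k) (f : R -> R -> V) : bilin f ->
  forall a b, bilin (fun c d => f (a * c) (b * d)).
Proof.
move=> fl a b; split=> [z|z] r x y /=; rewrite mulrDr -scalerAr.
  by rewrite bilinl.
by rewrite bilinr.
Qed.

Lemma bisum_tadd (V : lmodType k) (f : R -> R -> V) : bilin f -> forall x y,
  bisum f (trep (tadd x y)) = bisum f (trep x) + bisum f (trep y).
Proof. by move=> fl x y; rewrite trepE// bisum_cat. Qed.

Lemma bisum_tmul (V : lmodType k) (f : R -> R -> V) : bilin f -> forall x y,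
  bisum f (trep (tmul x y)) =
  bisum (fun a b => bisum (fun c d => f (a * c) (b * d)) (trep y)) (trep x).
Proof. by move=> fl x y; rewrite trepE// bisum_mul. Qed.

Lemma bisum_tensor (V : lmodType k) (f : R -> R -> V) : bilin f -> forall x y,
  bisum f (trep (tensor x y)) = f x y.
Proof. by move=> fl x y; rewrite trepE// /bisum big_seq1. Qed.

Lemma tensor_squareP (x y : T) : x = y <->
  forall (V : lmodType k) (f : R -> R -> V), bilin f ->
    bisum f (trep x) = bisum f (trep y).
Proof. by rewrite -{1}[x]trepK -{1}[y]trepK; exact: tclsP. Qed.

Fact taddA : associative tadd.
Proof.
by move=> x y z; apply/tensor_squareP => V f fl; rewrite !bisum_tadd// addrA.
Qed.

Fact taddC : commutative tadd.
Proof.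
by move=> x y; apply/tensor_squareP => V f fl; rewrite !bisum_tadd// addrC.
Qed.

Fact tadd0 : left_id (tcls [::]) tadd.
Proof.
move=> x; apply/tensor_squareP => V f fl.
by rewrite !bisum_tadd// trepE// [bisum f [::]]big_nil add0r.
Qed.

Fact taddN : left_inverse (tcls [::]) topp tadd.
Proof.
move=> x; apply/tensor_squareP => V f fl.
by rewrite bisum_tadd// !trepE// bisum_opp// addNr [RHS]big_nil.
Qed.

HB.instance Definition _ := GRing.isZmodule.Build T taddA taddC tadd0 taddN.

Fact tmulA : associative tmul.
Proof.
move=> x y z; apply/tensor_squareP => V f fl.
rewrite !bisum_tmul ?bisum_tmul//; last exact: bilin_bisum.
apply: eq_bisum => a b; rewrite bisum_tmul; last exact: bilin_mull.
apply: eq_bisum => c d; apply: eq_bisum => a' b'.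
by rewrite !mulrA.
Qed.

Fact tmulC : commutative tmul.
Proof.
move=> x y; apply/tensor_squareP => V f fl.
rewrite !bisum_tmul// bisumC; apply: eq_bisum => a b; apply: eq_bisum => c d.
by rewrite ![_ * a]mulrC ![_ * b]mulrC.
Qed.

Fact tmul1 : left_id (tensor 1 1) tmul.
Proof.
move=> x; apply/tensor_squareP => V f fl.
rewrite bisum_tmul// bisum_tensor; last exact: bilin_bisum.
by apply: eq_bisum => a b; rewrite !mul1r.
Qed.

Fact tmulDl : left_distributive tmul tadd.
Proof.
move=> x y z; apply/tensor_squareP => V f fl; rewrite bisum_tadd// !bisum_tmul//.
by rewrite bisum_tadd//; exact: bilin_bisum.
Qed.

Let bilin_mul : bilin (fun x y : R => x * y : R).
Proof.
by split=> z c x y; rewrite ?mulrDl ?mulrDr -?scalerAl -?scalerAr.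
Qed.

Fact tensor11_neq0 : tensor 1 1 != tcls [::].
Proof.
apply/eqP => /tensor_squareP /(_ _ _ bilin_mul).
rewrite bisum_tensor// mulr1 trepE// [bisum _ _]big_nil.
by move/eqP; rewrite oner_eq0.
Qed.

HB.instance Definition _ := GRing.Zmodule_isComNzRing.Build T
  tmulA tmulC tmul1 tmulDl tensor11_neq0.

Lemma bisum_tscale (V : lmodType k) (f : R -> R -> V) : bilin f -> forall c x,
  bisum f (trep (tscale c x)) = c *: bisum f (trep x).
Proof. by move=> fl c x; rewrite trepE// bisum_scale. Qed.

Fact tscaleA a b x : tscale a (tscale b x) = tscale (a * b) x.
Proof.
by apply/tensor_squareP => V f fl; rewrite !bisum_tscale// scalerA.
Qed.

Fact tscale1 : left_id 1 tscale.
Proof.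
by move=> x; apply/tensor_squareP => V f fl; rewrite bisum_tscale// scale1r.
Qed.

Fact tscaleDr : right_distributive tscale +%R.
Proof.
move=> c x y; apply/tensor_squareP => V f fl.
by rewrite bisum_tscale// !bisum_tadd// !bisum_tscale// scalerDr.
Qed.

Fact tscaleDl x : {morph tscale^~ x : a b / a + b}.
Proof.
move=> a b; apply/tensor_squareP => V f fl.
by rewrite bisum_tscale// bisum_tadd// !bisum_tscale// scalerDl.
Qed.

HB.instance Definition _ := GRing.Zmodule_isLmodule.Build k T
  tscaleA tscale1 tscaleDr tscaleDl.

Fact tscaleAl (c : k) (x y : T) : c *: (x * y) = (c *: x) * y.
Proof.
apply/tensor_squareP => V f fl; rewrite bisum_tscale// !bisum_tmul//.
by rewrite bisum_tscale//; exact: bilin_bisum.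
Qed.

HB.instance Definition _ := GRing.Lmodule_isLalgebra.Build k T tscaleAl.
HB.instance Definition _ := GRing.Lalgebra_isComAlgebra.Build k T.

Lemma tensor_bilinear : bilin tensor.
Proof.
split=> z c x y; apply/tensor_squareP => V f fl;
  rewrite bisum_tensor// bisum_tadd// bisum_tscale// !bisum_tensor//.
  exact: bilinl.
exact: bilinr.
Qed.

Lemma tensorM a b c d : tensor a b * tensor c d = tensor (a * c) (b * d).
Proof.
apply/tensor_squareP => V f fl; rewrite bisum_tmul//.
rewrite bisum_tensor; last exact: bilin_bisum.
by rewrite bisum_tensor ?bisum_tensor//; exact: bilin_mull.
Qed.

Lemma tensor_square_sum (x : T) :
  x = \sum_(ab <- trep x) tensor ab.1 ab.2.
Proof.
rewrite -{1}[x]trepK; elim: (trep x) => [|[a b] s IHs]; first by rewrite big_nil.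
rewrite big_cons -IHs; apply/tensor_squareP => V f fl.
by rewrite bisum_tadd// bisum_tensor// !trepE// [LHS]big_cons.
Qed.

(* Universal property: together with [tensor_square_sum], [bisum f \o trep] is
   the unique linear map sending x (x) y to f x y. *)
Lemma tensor_lift_linear (V : lmodType k) (f : R -> R -> V) : bilin f ->
  linear (fun x : T => bisum f (trep x)).
Proof. by move=> fl c x y /=; rewrite bisum_tadd// bisum_tscale. Qed.

Lemma tensor_liftE (V : lmodType k) (f : R -> R -> V) : bilin f ->
  forall x y, bisum f (trep (tensor x y)) = f x y.
Proof. exact: bisum_tensor. Qed.

Definition tensor_mu (x : T) : R := bisum (fun x y : R => x * y : R) (trep x).

Lemma tensor_muE x y : tensor_mu (tensor x y) = x * y.
Proof. exact: bisum_tensor. Qed.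

Fact tensor_mu_linear : linear tensor_mu.
Proof. exact: tensor_lift_linear. Qed.

HB.instance Definition _ := GRing.isLinear.Build k T R *:%R tensor_mu
  tensor_mu_linear.

Fact tensor_mu_monoid_morphism : monoid_morphism tensor_mu.
Proof.
split=> [|x y]; first by rewrite [LHS]tensor_muE mulr1.
rewrite [x]tensor_square_sum [y]tensor_square_sum.
rewrite mulr_suml !linear_sum mulr_suml; apply: eq_bigr => -[a b] _.
rewrite mulr_sumr !linear_sum mulr_sumr; apply: eq_bigr => -[c d] _.
by rewrite /= tensorM !tensor_muE mulrACA.
Qed.

HB.instance Definition _ := GRing.isMonoidMorphism.Build T R tensor_mu
  tensor_mu_monoid_morphism.

End TensorSquare.

Fact pchar_alg (k : fieldType) (A : comAlgType k) p :
  p \in [pchar k] -> p \in [pchar A].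
Proof. by rewrite pchar_lalg. Qed.

Definition diagonally_F_split (k : fieldType) (p : nat) (chk : p \in [pchar k])
    (R : comAlgType k) : Prop :=
  let T : comAlgType k := tensor_square R in
  exists2 e, (0 < e)%N &
    exists phi : {linear Fpush (pchar_alg T chk) e -> T^o},
      phi (1 : T) = 1 /\
      forall x : T, tensor_mu x = 0 -> tensor_mu (phi x : T) = 0.

(* Main.v *)
Require Import Defs.
From HB Require Import structures.
From mathcomp Require Import all_boot all_order all_algebra.
From mathcomp Require Import boolp classical_sets reals.
Import Order.TTheory GRing.Theory Num.Theory.
Local Open Scope classical_set_scope.
Local Open Scope ring_scope.

Set Implicit Arguments.
Unset Strict Implicit.
Unset Printing Implicit Defensive.

(* Iterating a compatible splitting makes q = p^e as large as needed, so that
   q eps >= 1. For x in a^(s+t), split x^q = sum_l u_l v_l with u_l in a^i,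
   v_l in a^j, (s - eps) q <= i and (t - eps) q <= j. Compatibility with ker mu
   gives x = sum_l mu (phi (u_l (x) v_l)). For a k-linear functional f on R,
   u |-> (id (x) f) (phi (u (x) v)) is an R-linear map F^e_* R -> R, so strong
   F-regularity puts its value at u_l in tau(a^(s - eps)); symmetrically on the
   other side. Hence phi (u_l (x) v_l) lies in both tau(a^(s - eps)) (x) R and
   R (x) tau(a^(t - eps)), whose intersection is the tensor product of the two
   test ideals, and mu maps it into their product. *)

(** * Functionals on vector spaces of arbitrary dimension *)

Lemma linear_pack (A : pzRingType) (U V : lmodType A) (f : U -> V) :
  linear f -> exists g : {linear U -> V}, g =1 f.
Proof.
move=> flin; pose fL := GRing.isLinear.Build A U V *:%R f flin.
by pose g : {linear U -> V} := HB.pack f fL; exists g.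
Qed.

(** Zorn gives a maximal subspace [A] avoiding [v]. Maximality forces [V = A + k v], and the
    coefficient of [v] modulo [A] is the functional. *)
Lemma exists_functional1 (k : fieldType) (V : lmodType k) (v : V) :
  v != 0 -> exists f : {linear V -> k^o}, f v = 1.
Proof.
move=> v0.
pose lin (A : set V) := forall c x y, A x -> A y -> A (c *: x + y).
have [|A [[Alin Av] Amax]] := @Zorn_bigcup V (fun A => lin A /\ ~ A v).
  move=> F FP Ftot; split=> [c x y [X FX Xx] [Y FY Yy]|[X /FP[_ nXv] //]].
  have [XY|YX] := Ftot _ _ FX FY.
    by exists Y => //; have [Ylin _] := FP _ FY; apply: Ylin => //; exact: XY.
  by exists X => //; have [Xlin _] := FP _ FX; apply: Xlin => //; exact: YX.
(* [lin] admits the empty set, as the empty chain requires; comparison with [[set 0]] excludes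
   it. *)
have A0 : A 0.
  have [[x Ax]|A_empty] := pselect (exists x, A x).
    by rewrite -(addNr x) -scaleN1r; exact: Alin.
  exfalso; apply: (Amax [set 0]).
    by split=> [x Ax|/(_ 0 erefl) A0]; case: A_empty; [exists x | exists 0].
  split=> [c x y -> ->|/= v0E]; first by rewrite scaler0 addr0.
  by rewrite v0E eqxx in v0.
have AZ c x : A x -> A (c *: x) by move=> Ax; rewrite -[_ *: _]addr0; exact: Alin.
have AD x y : A x -> A y -> A (x + y).
  by move=> Ax Ay; rewrite -[x]scale1r; exact: Alin.
have decomp x : exists c, A (x - c *: v).
  have [Ax|nAx] := pselect (A x); first by exists 0; rewrite scale0r subr0.
  (* [B = A + k x] is strictly larger than [A], so it contains [v]; that relation is then solved for
     [x]. *)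
  pose B := [set y | exists c, A (y - c *: x)].
  have [[c Ac]|nBv] := pselect (B v).
    have c0 : c != 0.
      by apply/eqP => c0; move: Ac; rewrite c0 scale0r subr0.
    exists c^-1; have := AZ (- c^-1) _ Ac.
    by rewrite scalerBr scalerA mulNr mulVf// !scaleNr scale1r opprK addrC.
  exfalso; apply: (Amax B).
    split=> [y Ay|BA]; first by exists 0; rewrite scale0r subr0.
    by apply: nAx; apply: BA; exists 1; rewrite scale1r subrr.
  split=> // c y z [b Ab] [d Ad]; exists (c * b + d).
  have -> : c *: y + z - (c * b + d) *: x = c *: (y - b *: x) + (z - d *: x).
    by rewrite scalerBr scalerDl scalerA opprD addrACA.
  exact: Alin.
have uniq x c d : A (x - c *: v) -> A (x - d *: v) -> c = d.
  move=> Ac Ad; apply/eqP; rewrite -subr_eq0; apply/negP => /negP cd0.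
  apply: Av; have := AZ (c - d)^-1 _ (AD _ _ Ad (AZ (-1) _ Ac)).
  have -> : x - d *: v + -1 *: (x - c *: v) = (c - d) *: v.
    by rewrite scaleN1r opprB addrC addrA subrK scalerBl.
  by rewrite scalerA mulVf// scale1r.
have [f fA] := choice decomp.
have [|g gE] := @linear_pack k V k^o f.
  move=> c x y; apply: uniq (fA _) _.
  rewrite scalerDl; set a := f x; set b := f y.
  have -> : c *: x + y - (((c *: (a : k^o)) : k) *: v + b *: v) =
            c *: (x - a *: v) + (y - b *: v).
    by rewrite scalerBr scalerA opprD addrACA.
  exact: Alin.
by exists g; rewrite gE; apply: (uniq v); [exact: fA | rewrite scale1r subrr].
Qed.

(** Induction on [s], which may be linearly dependent. If the earlier coordinates [P] do not
    reproduce [v], a functional [g] with value 1 at [v - P v] yields [x = P x + h x *: (v - P v)],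
    since [h] is 1 at [v] and 0 on the tail. *)
Lemma finite_span_coord (k : fieldType) (V : lmodType k) (s : seq V) :
  exists f : nat -> {linear V -> k^o},
    forall x, x \in s -> x = \sum_(l < size s) (f l x : k) *: s`_l.
Proof.
elim: s => [|v s [f fE]]; first by exists (fun=> \0 : {linear V -> k^o}).
pose P x := \sum_(l < size s) (f l x : k) *: s`_l.
have Plin : linear P.
  move=> c x y; rewrite /P scaler_sumr -big_split; apply: eq_bigr => l _ /=.
  by rewrite linearP scalerDl scalerA.
have [Pv|Pv] := eqVneq v (P v).
  exists (fun l => if l is l'.+1 then f l' else (\0 : {linear V -> k^o})) => x.
  rewrite inE big_ord_recl /= scale0r add0r => /predU1P[->|/fE //].
  exact: Pv.
have [|g gv] := @exists_functional1 k V (v - P v); first by rewrite subr_eq0.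
pose h x : k := g (x - P x).
have hlin : linear (h : V -> k^o).
  move=> c x y; rewrite /h -linearP Plin; congr (g _).
  by rewrite scalerBr opprD addrACA.
have [h' h'E] := @linear_pack k V k^o h hlin.
have fhlin l : linear ((fun x => f l x - h x * f l v) : V -> k^o).
  move=> c x y; rewrite linearP (hlin c x y : h _ = c * h x + h y) mulrDl.
  by rewrite -[c *: (_ - _)]/(c * (_ - _)) mulrBr mulrA opprD addrACA.
have [f' f'E] := choice (fun l => @linear_pack k V k^o _ (fhlin l)).
exists (fun l => if l is l'.+1 then f' l' else h') => x xs.
have xE : x = P x + h x *: (v - P v).
  move: xs; rewrite inE => /predU1P[->|xs].
    by rewrite /h gv scale1r addrC subrK.
  by rewrite /h /P -fE// subrr linear0 scale0r addr0.
rewrite big_ord_recl /= h'E {1}xE scalerBr addrCA; congr (_ + _).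
rewrite /P scaler_sumr -sumrB; apply: eq_bigr => l _ /=.
by rewrite f'E scalerBl scalerA.
Qed.

Lemma ideal_sum (R : comNzRingType) (I : set R) (J : eqType) (r : seq J)
    (F : J -> R) :
  is_ideal I -> (forall j, j \in r -> I (F j)) -> I (\sum_(j <- r) F j).
Proof.
case=> I0 ID _ IF; rewrite big_seq.
by elim/big_rec: _ => // j x jr; apply: ID; exact: IF.
Qed.

(** * Contraction of one tensor factor *)

Section Contraction.
Variables (k : fieldType) (R : comAlgType k).
Local Notation T := (tensor_square R).
Implicit Types (f : {linear R -> k^o}) (x : T).

(** This is [id (x) f] followed by [R (x) k = R]; [contractl] is the mirror image [f (x) id]. *)
Definition contractr f x : R := bisum (fun a b => (f b : k) *: a) (trep x).
Definition contractl f x : R := bisum (fun a b => (f a : k) *: b) (trep x).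

Let contractr_bilin f : bilinear_for *:%R *:%R (fun a b : R => (f b : k) *: a : R).
Proof.
split=> z c u v; first by rewrite scalerDr scalerA mulrC -scalerA.
by rewrite (linearP f c u v : f _ = c * f u + f v) scalerDl -scalerA.
Qed.

Let contractl_bilin f : bilinear_for *:%R *:%R (fun a b : R => (f a : k) *: b : R).
Proof.
split=> z c u v; last by rewrite scalerDr scalerA mulrC -scalerA.
by rewrite (linearP f c u v : f _ = c * f u + f v) scalerDl -scalerA.
Qed.

HB.instance Definition _ f := GRing.isLinear.Build k T R *:%R (contractr f)
  (tensor_lift_linear (contractr_bilin f)).
HB.instance Definition _ f := GRing.isLinear.Build k T R *:%R (contractl f)
  (tensor_lift_linear (contractl_bilin f)).

Lemma contractr_tensor f a b : contractr f (tensor a b) = (f b : k) *: a.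
Proof. exact: (tensor_liftE (contractr_bilin f)). Qed.

Lemma contractl_tensor f a b : contractl f (tensor a b) = (f a : k) *: b.
Proof. exact: (tensor_liftE (contractl_bilin f)). Qed.

(** Linearity over the surviving factor is what makes the contracted Frobenius maps below linear
    over [R]. *)
Lemma contractrM f a x : contractr f (tensor a 1 * x) = a * contractr f x.
Proof.
rewrite (tensor_square_sum x) mulr_sumr !linear_sum mulr_sumr.
apply: eq_bigr => -[b c] _.
by rewrite /= tensorM mul1r !contractr_tensor scalerAr.
Qed.

Lemma contractlM f a x : contractl f (tensor 1 a * x) = a * contractl f x.
Proof.
rewrite (tensor_square_sum x) mulr_sumr !linear_sum mulr_sumr.
apply: eq_bigr => -[b c] _.
by rewrite /= tensorM mul1r !contractl_tensor scalerAr.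
Qed.

Lemma tensorDl a b c : tensor (a + b) c = tensor a c + tensor b c :> T.
Proof.
by have [/(_ c 1 a b) + _] := tensor_bilinear R; rewrite scale1r => ->;
  congr (_ + _); exact: scale1r.
Qed.

Lemma tensorDr a b c : tensor c (a + b) = tensor c a + tensor c b :> T.
Proof.
by have [_ /(_ c 1 a b)] := tensor_bilinear R; rewrite scale1r => ->;
  congr (_ + _); exact: scale1r.
Qed.

Lemma tensor0l c : tensor 0 c = 0 :> T.
Proof. by apply: (addIr (tensor 0 c)); rewrite -tensorDl !add0r. Qed.

Lemma tensor0r c : tensor c 0 = 0 :> T.
Proof. by apply: (addIr (tensor c 0)); rewrite -tensorDr !add0r. Qed.

Lemma tensorZ c a b : tensor (c *: a) b = tensor a (c *: b) :> T.
Proof.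
have [/(_ b c a 0) + /(_ a c b 0)] := tensor_bilinear R.
by rewrite !addr0 tensor0l tensor0r !addr0 => -> ->.
Qed.

Lemma tensor_suml (J : Type) (r : seq J) (F : J -> R) c :
  tensor (\sum_(j <- r) F j) c = \sum_(j <- r) tensor (F j) c :> T.
Proof.
elim: r => [|j r IHr]; first by rewrite !big_nil tensor0l.
by rewrite !big_cons tensorDl IHr.
Qed.

Lemma tensor_sumr (J : Type) (r : seq J) (F : J -> R) c :
  tensor c (\sum_(j <- r) F j) = \sum_(j <- r) tensor c (F j) :> T.
Proof.
elim: r => [|j r IHr]; first by rewrite !big_nil tensor0r.
by rewrite !big_cons tensorDr IHr.
Qed.

(** [finite_span_coord], applied to the right components of a representative of [x], gives
    coefficients in [k] that can be moved to the left factors. *)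
Lemma contractr_expand x : exists n (f : 'I_n -> {linear R -> k^o}) (b : 'I_n -> R),
  x = \sum_l tensor (contractr (f l) x) (b l).
Proof.
have [f fE] := @finite_span_coord k R [seq ab.2 | ab <- trep x].
set s := [seq _ | _ <- _] in fE *.
exists (size s), (fun l => f l), (fun l => s`_l).
rewrite {1}(tensor_square_sum x).
under [RHS]eq_bigr => l _.
  rewrite /contractr /bisum tensor_suml; over.
rewrite exchange_big /= !big_seq; apply: eq_bigr => ab xab.
rewrite {1}(fE ab.2) ?map_f // tensor_sumr.
by apply: eq_bigr => l _; rewrite tensorZ.
Qed.

(* The linear-algebra identity [(I (x) R) /\ (R (x) J) = I (x) J] over a field,
   with membership in [I (x) R] tested by contracting the other factor. *)
Lemma mu_ideal_mul (I J : set R) x : is_ideal I -> is_ideal J ->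
  (forall f, I (contractr f x)) -> (forall f, J (contractl f x)) ->
  ideal_mul I J (tensor_mu x).
Proof.
move=> II IJ xI xJ; have [n [f [b xE]]] := contractr_expand x.
pose a l := contractr (f l) x.
have [g gE] := @finite_span_coord k R [seq a l | l <- enum 'I_n].
set s := [seq _ | _ <- _] in gE.
(* The left factors [a l], which lie in [I], are expanded in the same way; the coefficients
   [g m (a l)] move to the right and collect there into [contractl (g m) x], an element of [J]. *)
have xE' : x = \sum_(m < size s) tensor s`_m (contractl (g m) x).
  rewrite [LHS]xE; under [RHS]eq_bigr => m _.
    rewrite {1}xE linear_sum /= tensor_sumr; over.
  rewrite exchange_big; apply: eq_bigr => l _ /=.
  rewrite -/(a l) {1}(gE (a l)) ?map_f ?mem_enum // tensor_suml.
  by apply: eq_bigr => m _; rewrite contractl_tensor tensorZ.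
rewrite xE' linear_sum /=; apply: ideal_sum => [|m _]; first exact: ideal_gen_ideal.
rewrite tensor_muE; apply: sub_ideal_gen.
exists s`_m; last by exists (contractl (g m) x).
have /mapP[l _ ->] : s`_m \in s by exact: mem_nth.
exact: xI.
Qed.

End Contraction.

(** * Maps on [F^e_* R] obtained by contracting a map on the tensor square *)

Section FrobeniusContraction.
Variables (k : fieldType) (p : nat) (chk : p \in [pchar k]) (R : comAlgType k).
Local Notation T := (tensor_square R).
Variables (e : nat) (phi : {linear Fpush (pchar_alg T chk) e -> T^o}).
Variable f : {linear R -> k^o}.

Lemma tensorX a b n : (tensor a b : T) ^+ n = tensor (a ^+ n) (b ^+ n).
Proof. by elim: n => [|n IHn]; rewrite ?expr0// !exprS IHn tensorM. Qed.

(** Since [tensor r 1 ^+ (p ^ e)] is [tensor (r ^+ (p ^ e)) 1], a scalar on the varying factor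
    passes through [phi] and then through [contractr f]. *)
Lemma contractr_Fpush (v : R) :
  exists alpha : {linear Fpush (pchar_alg R chk) e -> R^o},
    forall u : R, alpha u = contractr f (phi (tensor u v : T)).
Proof.
have [|alpha alphaE] := @linear_pack R (Fpush (pchar_alg R chk) e) R^o
    (fun u : R => contractr f (phi (tensor u v : T))); last by exists alpha.
move=> r u w /=; rewrite -[RHS]/(r * _ + _) -contractrM -linearD.
congr (contractr f _); rewrite -[_ * _]/((tensor r 1 : T) *: (phi _ : T^o)) -linearP.
congr (phi _).
change (tensor (r ^+ (p ^ e) * (u : R) + w) v =
  (tensor r 1 : T) ^+ (p ^ e) * tensor u v + tensor w v :> T).
by rewrite tensorX expr1n tensorM mul1r tensorDl.
Qed.

Lemma contractl_Fpush (u : R) :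
  exists beta : {linear Fpush (pchar_alg R chk) e -> R^o},
    forall v : R, beta v = contractl f (phi (tensor u v : T)).
Proof.
have [|beta betaE] := @linear_pack R (Fpush (pchar_alg R chk) e) R^o
    (fun v : R => contractl f (phi (tensor u v : T))); last by exists beta.
move=> r v w /=; rewrite -[RHS]/(r * _ + _) -contractlM -linearD.
congr (contractl f _); rewrite -[_ * _]/((tensor 1 r : T) *: (phi _ : T^o)) -linearP.
congr (phi _).
change (tensor u (r ^+ (p ^ e) * (v : R) + w) =
  (tensor 1 r : T) ^+ (p ^ e) * tensor u v + tensor u w :> T).
by rewrite tensorX expr1n tensorM mul1r tensorDr.
Qed.

End FrobeniusContraction.

(** * Noetherian reduced rings: elements avoiding the minimal primes *)

Section NoetherianReduced.
Variable R : comNzRingType.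
Implicit Types (I J P A a : set R).

Lemma noetherian_max (F : set (set R)) :
  is_noetherian R -> F !=set0 -> F `<=` is_ideal (R := R) ->
  exists2 I, F I & forall J, F J -> I `<=` J -> J = I.
Proof.
move=> noeth [I0 FI0] FI.
(* Adjoining [set0] to [F] provides for the empty chain; [I_ne] discards it again. *)
have [|I [PI Imax]] := @Zorn_bigcup R (fun I => I = set0 \/ F I).
  move=> C CF Ctot; set U := \bigcup_(_ in _) _.
  have [U0|/set0P[x0 [X0 CX0 X0x0]]] := eqVneq U set0; [by left | right].
  have CI X x : C X -> X x -> is_ideal X.
    by move=> CX Xx; case: (CF _ CX) => [X_0|/FI //]; rewrite X_0 in Xx.
  have UI : is_ideal U.
    split=> [|x y [X CX Xx] [Y CY Yy]|r x [X CX Xx]].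
    - by exists X0 => //; have [] := CI _ _ CX0 X0x0.
    - have [XY|YX] := Ctot _ _ CX CY; [exists Y => // | exists X => //].
        by have [_ YD _] := CI _ _ CY Yy; apply: YD => //; exact: XY.
      by have [_ XD _] := CI _ _ CX Xx; apply: XD => //; exact: YX.
    - by exists X => //; have [_ _ XM] := CI _ _ CX Xx; exact: XM.
  have [s Us] := noeth _ UI.
  have [X CX [X0X sX]] : exists2 X, C X & X0 `<=` X /\ [set` s] `<=` X.
    have : [set` s] `<=` U by rewrite Us; exact: sub_ideal_gen.
    elim: (s) => [_|x t IHt xtU]; first exists X0 => //.
      by split=> [x //|x]; rewrite /= in_nil.
    have [|X CX [X0X tX]] := IHt.
      by move=> y ty; apply: xtU; rewrite /= inE; apply/orP; right.
    have [|Y CY Yx] := xtU x; first by rewrite /= inE eqxx.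
    have [XY|YX] := Ctot _ _ CX CY; [exists Y => // | exists X => //].
      split=> [y /X0X/XY //|y]; rewrite /= inE => /predU1P[-> //|/tX/XY //].
    split=> // y; rewrite /= inE => /predU1P[-> |/tX //]; exact: YX.
  have XI := CI _ _ CX (X0X _ X0x0).
  have -> : U = X.
    apply/seteqP; split=> [|x Xx]; last by exists X.
    by rewrite Us => x; apply.
  by case: (CF _ CX) => // X_0; have := X0X _ X0x0; rewrite X_0.
have I_ne : F I.
  case: PI => // I_0; exfalso; apply: (Imax I0); last by right.
  have [I00 _ _] := FI _ FI0.
  by rewrite I_0; split=> // /(_ _ I00).
exists I => // J FJ IJ; apply: contrapT => JI; apply: (Imax J); last by right.
by split=> // JI'; apply: JI; apply/seteqP.
Qed.

Definition ann A : set R := [set y | forall x, A x -> x * y = 0].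

Lemma ann_ideal A : is_ideal (ann A).
Proof.
split=> [x _|y z Ay Az x Ax|r y Ay x Ax]; first exact: mulr0.
  by rewrite mulrDr Ay// Az// addr0.
by rewrite mulrCA Ay// mulr0.
Qed.

(** Take [Q] maximal among the ideals disjoint from [S]. If [x] and [y] lie outside [Q], then
    [Q + R x] and [Q + R y] meet [S]; were [x * y] in [Q], the product of the two elements found
    would lie in both [Q] and [S]. *)
Lemma prime_disjoint (S : set R) : is_noetherian R -> is_mul_set S -> ~ S 0 ->
  exists2 Q, is_prime_ideal Q & Q `&` S = set0.
Proof.
move=> noeth [S1 SM] S0.
have [||Q [QI QS] Qmax] := @noetherian_max
    [set I | is_ideal I /\ I `&` S = set0] noeth.
- exists [set 0]; split; last first.
    by apply/seteqP; split=> // x [-> /S0].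
  by split=> [//|_ _ -> ->|r _ ->]; rewrite ?addr0 ?mulr0.
- by move=> I [].
have nQS x : Q x -> S x -> False by move=> Qx Sx; have : (Q `&` S) x by []; rewrite QS.
have [Q0 QD QM] := QI; exists Q => //; split=> // [Q1|x y Qxy]; first exact: nQS Q1 S1.
apply: contrapT => /not_orP[nQx nQy].
have extend z : ~ Q z -> exists q r, Q q /\ S (q + r * z).
  move=> nQz; pose J := [set q + r * z | q in Q & r in setT].
  apply: contrapT => nS; apply: nQz.
  have <- : J = Q.
    apply: Qmax; last by move=> q Qq; exists q => //; exists 0 => //; rewrite mul0r addr0.
    split; last first.
      by apply/seteqP; split=> // _ [[q Qq [r _ <-]] Sqr]; apply: nS; exists q, r.
    split.
    - by exists 0 => //; exists 0 => //; rewrite mul0r addr0.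
    - move=> _ _ [q Qq [r _ <-]] [q' Qq' [r' _ <-]].
      by exists (q + q'); [exact: QD | exists (r + r') => //; rewrite mulrDl addrACA].
    - move=> c _ [q Qq [r _ <-]].
      by exists (c * q); [exact: QM | exists (c * r) => //; rewrite mulrDr mulrA].
  by exists 0 => //; exists 1 => //; rewrite mul1r add0r.
have [q [r [Qq Sx]]] := extend _ nQx; have [q' [r' [Qq' Sy]]] := extend _ nQy.
apply: (nQS _ _ (SM _ _ Sx Sy)).
rewrite mulrDl [(r * x) * _]mulrDr addrA; apply: (QD); first apply: (QD).
- by rewrite mulrC; exact: QM.
- exact: QM.
- by rewrite mulrACA; exact: QM.
Qed.

(** This reflects that a reduced ring localizes to a field at a minimal prime. Otherwise the
    products [b ^+ n * y] with [y] outside [P] avoid 0, and a prime disjoint from them lies in [P]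
    without containing [b], against minimality. *)
Lemma minimal_prime_zero_divisor P b : is_noetherian R -> is_reduced R ->
  is_minimal_prime P -> P b -> exists2 y, ~ P y & b * y = 0.
Proof.
move=> noeth red [[PI P1 PM] Pmin] Pb; apply: contrapT => nex.
have nb y : ~ P y -> b * y <> 0 by move=> nPy by0; apply: nex; exists y.
pose S := [set x | exists n y, ~ P y /\ x = b ^+ n * y].
have [||Q Qprime QS] := @prime_disjoint S noeth.
- split; first by exists 0%N, 1; rewrite expr0 mulr1.
  move=> _ _ [m [x [nPx ->]]] [n [y [nPy ->]]]; exists (m + n)%N, (x * y).
  by split; [case/PM | rewrite exprD mulrACA].
- move=> [n [y [nPy bny]]]; apply: (nb _ nPy); apply: (red _ n.+1).
  by rewrite exprMn exprSr [y ^+ _]exprS mulrACA -bny mul0r.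
have nQS x : Q x -> S x -> False by move=> Qx Sx; have : (Q `&` S) x by []; rewrite QS.
have QP : Q `<=` P.
  move=> x Qx; apply: contrapT => nPx; apply: (nQS x Qx).
  by exists 0%N, x; rewrite expr0 mul1r.
apply: (nQS b); first by rewrite (Pmin Q).
by exists 1%N, 1; rewrite expr1 mulr1.
Qed.

(* Adding to [b] an element of [a] annihilated by [b] shrinks the annihilator
   of [b], because [R] is reduced; hence a [b] in [a] whose double annihilator
   is maximal lies in no minimal prime. *)
Lemma ideal_meets_off_minimal_primes a : is_noetherian R -> is_reduced R ->
  is_ideal a -> (forall P, is_minimal_prime P -> ~ a `<=` P) ->
  exists2 b, a b & off_minimal_primes b.
Proof.
move=> noeth red aI amin; have [a0 aD aM] := aI.
pose dann b := ann (ann [set b]).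
have [||_ [b ab <-] bmax] := @noetherian_max [set dann b | b in a] noeth.
- by exists (dann 0), 0.
- by move=> _ [b _ <-]; exact: ann_ideal.
exists b => // P Pmin Pb.
have [y nPy by0] := minimal_prime_zero_divisor noeth red Pmin Pb.
have [f [af nPf]] : exists f, a f /\ ~ P f.
  apply: contrapT => nf; apply: (amin P Pmin) => f af.
  by apply: contrapT => ?; apply: nf; exists f.
(* Both factors avoid [P], so [g] is nonzero; [y] makes [g] kill [b], and [f] puts it in [a]. *)
pose g := y * f; have ag : a g by exact: aM.
have bg0 : b * g = 0 by rewrite mulrA by0 mul0r.
have g0 : g <> 0.
  have [[[P0 _ _] _ PM] _] := Pmin; move=> g0.
  by have /PM[] : P (y * f) by rewrite -/g g0.
have sq0 (z : R) : z * z = 0 -> z = 0 by move=> zz; apply: (red z 2%N).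
have ann_bg z : (b + g) * z = 0 -> b * z = 0 /\ g * z = 0.
  move=> bgz; have bz : b * z = 0.
    by apply: sq0; rewrite mulrACA -[b * b]addr0 -bg0 -mulrDr mulrACA bgz mulr0.
  by split=> //; rewrite -bgz mulrDl bz add0r.
have sub : dann b `<=` dann (b + g).
  move=> w bw z zbg; apply: bw => x ->.
  by have [] := ann_bg z (zbg _ erefl).
have /= bgE := bmax _ (ex_intro2 _ _ (b + g) (aD _ _ ab ag) erefl) sub.
apply: g0; apply: sq0.
(* By maximality [dann b] also contains [g], which kills [b]; so [g * g = 0]. *)
have : dann (b + g) g.
  by move=> z zbg; have [_] := ann_bg z (zbg _ erefl); rewrite mulrC.
by rewrite bgE; apply=> _ ->.
Qed.

End NoetherianReduced.

(** * Products and powers of ideals *)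

Section IdealProducts.
Variable R : comNzRingType.
Implicit Types (I J a : set R).

(** Finite sums of products already form an ideal, scalars being absorbed into the left factors. *)
Lemma ideal_mul_sum I J x : is_ideal I -> ideal_mul I J x ->
  exists s : seq (R * R),
    (forall uv, uv \in s -> I uv.1 /\ J uv.2) /\ x = \sum_(uv <- s) uv.1 * uv.2.
Proof.
move=> [_ _ IM] xIJ; apply: (xIJ [set x | exists s : seq (R * R),
  (forall uv, uv \in s -> I uv.1 /\ J uv.2) /\ x = \sum_(uv <- s) uv.1 * uv.2]);
  last first.
  move=> _ [u Iu [v Jv <-]]; exists [:: (u, v)]; rewrite big_seq1; split=> // uv.
  by rewrite inE => /eqP->.
split.
- by exists [::]; rewrite big_nil.
- move=> _ _ [s [sIJ ->]] [t [tIJ ->]]; exists (s ++ t); rewrite big_cat.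
  by split=> // uv; rewrite mem_cat => /orP[/sIJ|/tIJ].
- move=> r _ [s [sIJ ->]]; exists [seq (r * uv.1, uv.2) | uv <- s].
  rewrite big_map mulr_sumr; split=> [_ /mapP[uv /sIJ[Iu Jv] ->]|].
    by split=> //=; exact: IM.
  by apply: eq_bigr => uv _; rewrite mulrA.
Qed.

(** The inclusion opposite to [ideal_expD], used to split a power at a prescribed exponent. *)
Lemma ideal_exp_add a i j :
  ideal_exp a (i + j) `<=` ideal_mul (ideal_exp a i) (ideal_exp a j).
Proof.
elim: i => [|i IHi] x.
  by move=> ax; apply: sub_ideal_gen; exists 1 => //; exists x => //; rewrite mul1r.
apply; first exact: ideal_gen_ideal.
move=> _ [u au [v /IHi av <-]].
have [J0 JD JM] := ideal_gen_ideal
  [set x * y | x in ideal_exp a i.+1 & y in ideal_exp a j].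
apply: (av [set v | ideal_mul (ideal_exp a i.+1) (ideal_exp a j) (u * v)]).
  split=> /=; first by rewrite mulr0.
    by move=> y z uy uz; rewrite mulrDr; exact: JD.
  by move=> r y uy; rewrite mulrCA; exact: JM.
move=> _ [y ay [z az <-]]; rewrite /= mulrA; apply: sub_ideal_gen.
exists (u * y); last by exists z.
by apply: sub_ideal_gen; exists u => //; exists y.
Qed.

Lemma off_minimal_primesX (b : R) n :
  off_minimal_primes b -> off_minimal_primes (b ^+ n).
Proof.
move=> bR P Pmin; have [[_ P1 PM] _] := Pmin.
by elim: n => [|n IHn]; rewrite ?expr0// exprS => /PM[/bR|/IHn]; exact.
Qed.

End IdealProducts.

(** * Test elements and membership in test ideals *)

Section TestIdealMembership.
Variables (R : comNzRingType) (p : nat) (chR : p \in [pchar R]).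
Variables (K : realType) (a : set R) (t : K).
Hypotheses (R_sFr : strongly_F_regular chR) (aI : is_ideal a) (t_ge0 : 0 <= t).

(** Dropping the [- 1] leaves a condition that scales exactly under further Frobenii. *)
Lemma le_absz_ceil e i : t * p%:R ^+ e <= i%:R ->
  (`|Num.ceil (t * (p%:R ^+ e - 1))|%N <= i)%N.
Proof.
have p1 : 1 <= p%:R :> K by rewrite ler1n (prime_gt0 (pcharf_prime chR)).
have ce0 : 0 <= t * (p%:R ^+ e - 1) by rewrite mulr_ge0// subr_ge0 exprn_ege1.
move=> tpi; rewrite -lez_nat gez0_abs; last first.
  by rewrite ceil_ge0; apply: lt_le_trans ce0; rewrite ltrN10.
rewrite ceil_le_int; apply: le_trans tpi.
by rewrite ler_wpM2l// gerBl.
Qed.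

(** [b ^+ m] works for [b] in [a] off the minimal primes and [m > t]: if [phi d = 1], then [phi]
    sends [d * b ^+ (m * p ^ e)] to [b ^+ m]. Existence keeps [xget] in [test_ideal] from returning
    its default 0. *)
Lemma exists_test_element : (forall P, is_minimal_prime P -> ~ a `<=` P) ->
  exists c, is_test_element chR a t c.
Proof.
have [_ red noeth sFr] := R_sFr => amin.
have [b ab bR] := ideal_meets_off_minimal_primes noeth red aI amin.
pose m := (Num.truncn t).+1.
exists (b ^+ m); split=> [|d dR]; first exact: off_minimal_primesX.
have [e e0 [phi phid]] := sFr _ dR.
exists e => //; exists phi, (b ^+ (m * p ^ e)).
  apply: (@ideal_exp_le _ _ _ (m * p ^ e)) => //.
    apply: le_absz_ceil; rewrite natrM natrX ler_wpM2r ?exprn_ge0 ?ler0n//.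
    by rewrite ltW// truncnS_gt.
  have a1 : ideal_exp a 1 b.
    by apply: sub_ideal_gen; exists b => //; exists 1 => //; rewrite mulr1.
  by have := ideal_expX (m * p ^ e) a1; rewrite mul1n.
rewrite mulrC exprM -[_ ^+ _ * d]/((b ^+ m) *: (d : Fpush chR e)) linearZ phid.
exact: mulr1.
Qed.

(* Strong F-regularity inserts the factor [c] demanded by [test_sum] at the
   price of finitely many further Frobenii, which leave the exponent ratio
   [i / p ^ e] unchanged. *)
Lemma test_sum_mem c e (alpha : {linear Fpush chR e -> R^o}) i u :
  off_minimal_primes c -> ideal_exp a i u -> t * p%:R ^+ e <= i%:R ->
  test_sum chR a t c (alpha u).
Proof.
move=> cR au tpi; have [_ _ _ /(_ c cR)[e' e'0 [phi phic]]] := R_sFr.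
apply: sub_ideal_gen; exists (e' + e)%N; first by rewrite addn_gt0 e'0.
exists (Fpush_comp alpha phi), (u ^+ (p ^ e')).
  apply: (@ideal_exp_le _ _ _ (i * p ^ e')) => //; last exact: ideal_expX.
  apply: le_absz_ceil; rewrite exprD natrM natrX mulrCA [leLHS]mulrC.
  by rewrite ler_wpM2r// exprn_ge0// ler0n.
rewrite /= /Fpush_comp mulrC; congr (alpha _).
rewrite -[_ ^+ _ * c]/(u *: (c : Fpush chR e')) linearZ phic.
exact: mulr1.
Qed.

Lemma test_ideal_mem e (alpha : {linear Fpush chR e -> R^o}) i u :
  (forall P, is_minimal_prime P -> ~ a `<=` P) ->
  ideal_exp a i u -> t * p%:R ^+ e <= i%:R -> test_ideal chR a t (alpha u).
Proof.
move=> amin; rewrite /test_ideal; have [c cT] := exists_test_element amin.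
by case: xgetP => [c' _ [c'R _]|/(_ _ cT)//]; exact: test_sum_mem.
Qed.

End TestIdealMembership.

(** * Iterating the diagonal splitting *)

Section DiagonalSplittingIterates.
Variables (k : fieldType) (p : nat) (chk : p \in [pchar k]) (R : comAlgType k).
Local Notation T := (tensor_square R).

Lemma diagonally_F_split_large N : diagonally_F_split chk R ->
  exists2 e, (N <= e)%N &
    exists phi : {linear Fpush (pchar_alg T chk) e -> T^o},
      phi (1 : T) = 1 /\
      forall x : T, tensor_mu x = 0 -> tensor_mu (phi x : T) = 0.
Proof.
move=> [e0 e00 [phi0 [phi01 phi0mu]]].
elim: N => [|N [e Ne [phi [phi1 phimu]]]]; first by exists e0 => //; exists phi0.
exists (e0 + e)%N; first by rewrite -add1n leq_add.
exists (Fpush_comp phi phi0); split=> [|x x0] /=; rewrite /Fpush_comp.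
  by rewrite phi01.
by apply: phimu; exact: phi0mu.
Qed.

Variables (e : nat) (phi : {linear Fpush (pchar_alg T chk) e -> T^o}).
Hypotheses (phi1 : phi (1 : T) = 1).
Hypothesis phimu : forall x : T, tensor_mu x = 0 -> tensor_mu (phi x : T) = 0.

(** [y] and [tensor x 1 ^+ (p ^ e)] agree modulo the kernel of [tensor_mu], which [phi] preserves,
    and [phi] sends the latter to [tensor x 1]. *)
Lemma diagonal_splitting_root (x : R) (y : T) :
  tensor_mu y = x ^+ (p ^ e) -> tensor_mu (phi y : T) = x.
Proof.
move=> yx; pose z : T := (tensor x 1 : T) ^+ (p ^ e).
have -> : phi y = phi (y - z : T) + phi z.
  by rewrite -linearD; congr (phi _); rewrite subrK.
rewrite linearD /= phimu; last first.
  by rewrite linearB /= yx rmorphXn /= tensor_muE mulr1 subrr.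
have -> : phi z = tensor x 1.
  have -> : z = ((tensor x 1 : T) *: (1 : Fpush (pchar_alg T chk) e) : Fpush _ _).
    by rewrite -[RHS]/(z * (1 : T)) mulr1.
  by rewrite linearZ phi1; exact: mulr1.
by rewrite add0r tensor_muE mulr1.
Qed.

End DiagonalSplittingIterates.

(** * Splitting the exponent and assembling the containment *)

Theorem theoremA (k : fieldType) (p : nat) (chk : p \in [pchar k])
  (k_F_finite : F_finite chk)
  (R : comAlgType k)
  (R_sFr : strongly_F_regular (pchar_alg R chk))
  (R_eft : is_ess_finite_type R)
  (R_diag : diagonally_F_split chk R)
  (a : set R) (a_ideal : is_ideal a)
  (a_min : forall P : set R, is_minimal_prime P -> ~ a `<=` P)
  (K : realType) (s t : K) (s_gt0 : 0 < s) (t_gt0 : 0 < t)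
  (st_int : s + t \is a Num.int)
  (eps : K) (eps_gt0 : 0 < eps) (eps_le : eps <= Num.min s t) :
  ideal_exp a (Num.truncn (s + t)) `<=`
    ideal_mul (test_ideal (pchar_alg R chk) a (s - eps))
              (test_ideal (pchar_alg R chk) a (t - eps)).
Proof.
move=> x ax; move: eps_le; rewrite le_min => /andP[eps_s eps_t].
set n := Num.truncn _ in ax.
have nE : n%:R = s + t.
  by apply: truncnK; rewrite -intrEge0 // addr_ge0 // ltW.
have p_gt1 : (1 < p)%N := prime_gt1 (pcharf_prime chk).
(* [N > 1 / eps] and [p ^ e > e >= N] give [eps * p ^ e >= 1]. *)
pose N := (Num.truncn eps^-1).+1.
have [e Ne [phi [phi1 phimu]]] := diagonally_F_split_large N R_diag.
have q_large : 1 <= eps * p%:R ^+ e.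
  rewrite mulrC -ler_pdivrMr // mul1r -natrX (le_trans (ltW (truncnS_gt _))) // ler_nat.
  exact: leq_trans Ne (ltnW (ltn_expl e p_gt1)).
(* Rounding [s * p ^ e] down costs less than 1, which [eps * p ^ e] covers. *)
pose i := Num.truncn (s * p%:R ^+ e).
have sq_ge0 : 0 <= s * p%:R ^+ e by rewrite mulr_ge0 ?ltW// exprn_gt0// ltr0n ltnW.
have i_le : i%:R <= s * p%:R ^+ e by rewrite truncn_le.
have i_ge : (s - eps) * p%:R ^+ e <= i%:R.
  rewrite mulrBl lerBlDr (le_trans (ltW (truncnS_gt _))) // -/i -natr1.
  by rewrite lerD2l.
(* This makes the truncated subtraction defining [j] exact. *)
have le_in : (i <= n * p ^ e)%N.
  rewrite -(ler_nat K) natrM natrX nE mulrDl (le_trans i_le) // lerDl.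
  by rewrite mulr_ge0 ?ltW// exprn_gt0// ltr0n ltnW.
pose j := (n * p ^ e - i)%N.
have j_ge : (t - eps) * p%:R ^+ e <= j%:R.
  rewrite natrB // natrM natrX nE lerBrDr mulrBl mulrDl addrC.
  rewrite (le_trans (lerD i_le (lexx _))) // addrA lerBlDr lerDl.
  by rewrite (le_trans ler01).
have axq : ideal_exp a (i + j) (x ^+ (p ^ e)) by rewrite subnKC //; exact: ideal_expX.
have [w [wij xqE]] := ideal_mul_sum (ideal_exp_ideal a i) (ideal_exp_add axq).
(* A lift of [x ^+ (p ^ e)] along [tensor_mu], with factors in the prescribed powers of [a]. *)
pose y : tensor_square R := \sum_(uv <- w) tensor uv.1 uv.2.
have yE : tensor_mu y = x ^+ (p ^ e).
  by rewrite xqE linear_sum; apply: eq_bigr => uv _ /=; rewrite tensor_muE.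
rewrite -(diagonal_splitting_root phi1 phimu yE).
have -> : phi y = \sum_(uv <- w) phi (tensor uv.1 uv.2 : tensor_square R).
  exact: (linear_sum phi).
rewrite linear_sum /=; apply: ideal_sum => [|uv /wij[au av]].
  exact: ideal_gen_ideal.
(* With one component fixed, contraction applies a map [F^e_* R -> R] to the other, which lies in
   [a^i] or [a^j]; [eps <= s] and [eps <= t] keep the exponents of the test ideals nonnegative. *)
apply: mu_ideal_mul => [| |f|f]; try exact: ideal_gen_ideal.
  have [alpha <-] := contractr_Fpush phi f uv.2.
  by apply: test_ideal_mem au i_ge; rewrite ?subr_ge0.
have [beta <-] := contractl_Fpush phi f uv.1.
by apply: test_ideal_mem av j_ge; rewrite ?subr_ge0.
Qed.
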